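(* Let $(\boldsymbol{w}_i)_{i\ge 0}$ be a sequence of random vectors in $\mathbb{R}^M$ generated by $\boldsymbol{w}_i=\mathcal{T}(\boldsymbol{w}_{i-1};\boldsymbol{x}_i)$, $i\ge 1$, where the (possibly stochastic and time-varying) mapping $\mathcal{T}$ is mean-square contractive around the mean-square fixed points $\boldsymbol{w}_i^{\infty}$ with deterministic rates $\gamma_i\in[0,1)$ and deterministic driving terms $\delta_i\ge 0$. Suppose there are constants $\Gamma\in[0,1)$ and $\Delta\ge 0$ with $\gamma_i\le\Gamma$ and $\delta_i\le\Delta$ for all $i\ge 1$. Suppose further that the fixed points follow the random walk $\boldsymbol{w}_i^{\infty}=\boldsymbol{w}_{i-1}^{\infty}+\boldsymbol{q}_i$ for $i\ge 1$, where $\boldsymbol{q}_i$ is independent of $\boldsymbol{w}_{i-1}^{\infty}$ and $\mathbb{E}\|\boldsymbol{q}_i\|^2\le\xi^2$ for all $i$ (the $\boldsymbol{q}_i$ may be non-stationary and have non-zero mean). Let $\widetilde{\boldsymbol{w}}_i=\boldsymbol{w}_i^{\infty}-\boldsymbol{w}_i$ and suppose $\mathbb{E}\|\widetilde{\boldsymbol{w}}_0\|^2<\infty$. Then: (1) For all $i\ge 1$, $$\mathbb{E}\|\widetilde{\boldsymbol{w}}_i\|^2\le O\big(\Gamma^{i/2}\big)+\frac{\xi^2}{(1-\sqrt{\Gamma})^2}+\frac{\Delta}{1-\sqrt{\Gamma}}.$$ (2) In the case when $\mathbb{E}\,\boldsymbol{q}_i=0$ for all $i$, the tighter bound $$\mathbb{E}\|\widetilde{\boldsymbol{w}}_i\|^2\le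 O\big(\Gamma^{i}\big)+\frac{\xi^2}{1-\Gamma}+\frac{\Delta}{1-\Gamma}$$ holds for all $i\ge 1$. Here $O(\Gamma^{i/2})$ and $O(\Gamma^i)$ denote terms bounded by $C\,\Gamma^{i/2}$ and $C\,\Gamma^{i}$ respectively, for a finite constant $C$ not depending on $i$.
   Context: All random variables live on a common probability space, $\|\cdot\|$ is the Euclidean norm, and $\boldsymbol{x}_i$ is the random data observed at time $i$, whose distribution may vary with $i$. Mean-square contraction: a mapping $\boldsymbol{w}_i=\mathcal{T}(\boldsymbol{w}_{i-1};\boldsymbol{x}_i)$ is called mean-square contractive around a mean-square fixed-point $\boldsymbol{w}_i^{\infty}$ (a possibly random vector in $\mathbb{R}^M$, which may vary with $i$) if for any $\boldsymbol{w}_i$ generated by the mapping $$\mathbb{E}\|\boldsymbol{w}_i^{\infty}-\boldsymbol{w}_i\|^2\le\gamma_i\,\mathbb{E}\|\boldsymbol{w}_i^{\infty}-\boldsymbol{w}_{i-1}\|^2+\delta_i,$$ with $\gamma_i<1$. The point $\boldsymbol{w}_i^{\infty}$, the rate of contraction $\gamma_i$ and the additive driving term $\delta_i$ may all depend on the distribution of $\boldsymbol{x}_i$ and hence on time $i$. The left-hand side involves the updated iterate $\boldsymbol{w}_i$ and the right-hand side the previous iterate $\boldsymbol{w}_{i-1}$, both compared with the current fixed point $\boldsymbol{w}_i^{\infty}$.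
   Formalization: Part (2) additionally assumes that q_i is independent of the previous iterate w_{i-1} for all i ≥ 1; with independence from the fixed point w_{i-1}^∞ alone, the tighter bound is false. *)

(* Defs.v *)
From HB Require Import structures.
From mathcomp Require Import all_boot all_order all_algebra.
From mathcomp Require Import all_classical all_reals all_analysis.

Set Implicit Arguments.
Unset Strict Implicit.
Unset Printing Implicit Defensive.

Import Order.TTheory GRing.Theory Num.Theory.
Import numFieldNormedType.Exports.

Local Open Scope classical_set_scope.
Local Open Scope ring_scope.

(* Product sigma-algebra on row vectors, generated by the coordinate maps, as
   the library does for tuples.  Over the reals these are the Borel sets. *)
Section measurable_rV.
Context {d} {T : sigmaRingType d}.
Variable n : nat.

Let coors : 'I_n -> 'rV[T]_n -> T := fun j v => v ord0 j.

Let rV_set0 : g_sigma_preimage coors set0.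
Proof. exact: sigma_algebra0. Qed.

Let rV_setC A : g_sigma_preimage coors A -> g_sigma_preimage coors (~` A).
Proof. exact: sigma_algebraC. Qed.

Let rV_bigcup (F : (set 'rV[T]_n)^nat) :
  (forall i, g_sigma_preimage coors (F i)) ->
  g_sigma_preimage coors (\bigcup_i (F i)).
Proof. exact: sigma_algebra_bigcup. Qed.

HB.instance Definition _ := @isMeasurable.Build (measure_tuple_display d)
  'rV[T]_n (g_sigma_preimage coors) rV_set0 rV_setC rV_bigcup.

End measurable_rV.

(* The library's norm on matrices is the max norm, hence this definition. *)
Definition enorm (R : realType) (M : nat) (v : 'rV[R]_M) : R :=
  Num.sqrt (\sum_(j < M) v ord0 j ^+ 2).

(* Possibly +oo. *)
Definition mean_sq (d : measure_display) (Omega : measurableType d)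
    (R : realType) (P : probability Omega R) (M : nat)
    (u : Omega -> 'rV[R]_M) : \bar R :=
  'E_P[(fun t => enorm (u t) ^+ 2)%R]%E.

Definition mean_zero (d : measure_display) (Omega : measurableType d)
    (R : realType) (P : probability Omega R) (M : nat)
    (u : Omega -> 'rV[R]_M) : Prop :=
  forall j : 'I_M, 'E_P[fun t => u t ord0 j]%E = 0%E.

Definition independent_RV (d d1 d2 : measure_display)
    (Omega : measurableType d) (T1 : measurableType d1)
    (T2 : measurableType d2) (R : realType) (P : probability Omega R)
    (X : {RV P >-> T1}) (Y : {RV P >-> T2}) : Prop :=
  forall (A : set T1) (B : set T2), measurable A -> measurable B ->
    P (X @^-1` A `&` Y @^-1` B) = (P (X @^-1` A) * P (Y @^-1` B))%E.

(* T i is the mapping applied at time i; its randomness enters through the data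
   x i, which take values in an arbitrary measurable space. *)
Definition generated (d dX : measure_display) (Omega : measurableType d)
    (X : measurableType dX) (R : realType) (P : probability Omega R) (M : nat)
    (T : nat -> 'rV[R]_M -> X -> 'rV[R]_M) (x : nat -> {RV P >-> X})
    (w : nat -> {RV P >-> 'rV[R]_M}) : Prop :=
  forall i t, w i.+1 t = T i.+1 (w i t) (x i.+1 t).

(* The product with an infinite mean square uses the convention 0 * oo = 0. *)
Definition ms_contractive (d dX : measure_display) (Omega : measurableType d)
    (X : measurableType dX) (R : realType) (P : probability Omega R) (M : nat)
    (T : nat -> 'rV[R]_M -> X -> 'rV[R]_M) (x : nat -> {RV P >-> X})
    (winf : nat -> {RV P >-> 'rV[R]_M}) (gamma delta : nat -> R) : Prop :=
  (forall i, gamma i.+1 < 1) /\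
  (forall w : nat -> {RV P >-> 'rV[R]_M}, generated T x w -> forall i,
    (mean_sq P (fun t => winf i.+1 t - w i.+1 t)%R <=
     (gamma i.+1)%:E * mean_sq P (fun t => winf i.+1 t - w i t)%R
       + (delta i.+1)%:E)%E).

(* Main.v *)
Require Import Defs.
From HB Require Import structures.
From mathcomp Require Import all_boot all_order all_algebra.
From mathcomp Require Import all_classical all_reals all_analysis.
From mathcomp Require Import measurable_realfun.
From mathcomp Require Import ring lra.

Import Order.TTheory GRing.Theory Num.Theory.
Import numFieldNormedType.Exports.

Local Open Scope classical_set_scope.
Local Open Scope ring_scope.

(** Write [a i] for the mean-square error of the iterate, [d i] for the error
    [winf i - w i] itself.  Since [winf i.+1 - w i = d i + q i.+1], the
    contraction gives
      [a i.+1 <= Gamma * E||d i + q i.+1||^2 + Delta],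
    and everything depends on how the square of the sum is split.

    In general, convexity of the square gives, for [0 < s < 1],
      [||u + v||^2 <= ||u||^2 / s + ||v||^2 / (1 - s)]   ([mean_sqD_le]).
    With [s = sqrt Gamma] the recursion becomes affine,
      [a i.+1 <= s * a i + Gamma * xi^2 / (1 - s) + Delta],
    and unrolling it ([affine_recursion]), with [Gamma <= 1], yields the rate
    [s^i] and the constant [xi^2 / (1 - s)^2 + Delta / (1 - s)].

    For centred increments the cross term [E<q i.+1, d i>] vanishes
    ([orthogonal_difference]), so that mean squares add up
    ([mean_sqD_orthogonal]) and the recursion has rate [Gamma] itself.  The
    delicate point is that [q i.+1] is independent of [winf i] and of [w i]
    separately, perhaps not of the pair, while neither [winf i] nor [w i] has to be
    integrable: only their difference is square-integrable.  One cannot split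
    the expectation of [q * (winf - w)] by linearity.  Instead, both variables
    are first truncated at level [n]; the product rule for independent variables
    ([expectation_mul_independent]) kills both truncated terms, and since
    truncation is 1-Lipschitz the truncated differences are dominated by
    [|winf - w|] uniformly in [n], so dominated convergence removes the
    truncation. *)

(** * Affine recursions and coordinates *)

Lemma affine_recursion (R : realType) (a : nat -> \bar R) (rho b c : R) :
  0 <= rho < 1 -> 0 <= b ->
  (a 0%N <= c%:E)%E -> (forall i, (a i.+1 <= rho%:E * a i + b%:E)%E) ->
  forall i, (a i <= (c * rho ^+ i + b / (1 - rho))%:E)%E.
Proof.
move=> /andP[rho0 rho1] b0 a0 aS.
have rho1' : 0 < 1 - rho by rewrite subr_gt0.
elim=> [|i IH].
  rewrite (le_trans a0)// lee_fin expr0 mulr1 lerDl.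
  by rewrite divr_ge0// ltW.
rewrite (le_trans (aS i))//.
rewrite (@le_trans _ _ (rho%:E * (c * rho ^+ i + b / (1 - rho))%:E + b%:E)%E)//.
  by rewrite leeD2r// lee_wpmul2l.
rewrite -EFinM -EFinD lee_fin le_eqVlt; apply/orP; left; apply/eqP.
rewrite exprS; field.
by rewrite gt_eqF.
Qed.

Lemma measurable_coord (R : realType) (M : nat) (j : 'I_M) :
  measurable_fun [set: 'rV[R]_M] (fun v => v ord0 j).
Proof.
move=> _ Y mY; rewrite setTI; apply: sub_sigma_algebra => /=.
rewrite -bigcup_seq/=; exists j => /=; first by rewrite mem_index_enum.
by exists Y => //; rewrite setTI.
Qed.

(** * Truncation of real numbers *)

Section clamp.
Variable R : realType.
Implicit Types x y : R.

Definition clamp (n : nat) y : R := Num.max (- n%:R) (Num.min y n%:R).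

Lemma clamp_le n y : `|clamp n y| <= n%:R.
Proof.
have n0 : (0 : R) <= n%:R by [].
rewrite ler_norml /clamp le_max lexx/= ge_max ge_min lexx orbT andbT.
by rewrite (@le_trans _ _ 0)// oppr_le0.
Qed.

(** Makes a difference of truncations dominated by the untruncated
    difference, even when the two terms are not integrable. *)
Lemma clamp_lipschitz n x y : `|clamp n x - clamp n y| <= `|x - y|.
Proof.
have c0 : (0 : R) <= n%:R by [].
rewrite /clamp; move: (n%:R) c0 => c c0.
rewrite !maxEle !minEle ler_norml.
by case: (leP x c) => ?; case: (leP y c) => ?; case: (leP (- c) c) => ?;
  case: (leP (- c) x) => ?; case: (leP (- c) y) => ?;
  case: (ger0P (x - y)) => ?; apply/andP; split; lra.
Qed.

Lemma clamp_id n y : `|y| <= n%:R -> clamp n y = y.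
Proof.
by rewrite ler_norml => /andP[? ?]; rewrite /clamp min_l// max_r.
Qed.

Lemma measurable_clamp n : measurable_fun [set: R] (clamp n).
Proof. by apply: measurable_maxr => //; exact: measurable_minr. Qed.

Lemma cvg_clamp y : clamp n y @[n --> \oo] --> y.
Proof.
apply: cvg_near_cst; near=> n; apply: clamp_id.
near: n; exact: nbhs_infty_ger.
Unshelve. all: by end_near. Qed.
End clamp.


(** * Expectation of a product of independent variables *)

Section independence.
Context {d d1 d2 : measure_display} {Omega : measurableType d}
  {T1 : measurableType d1} {T2 : measurableType d2} {R : realType}
  {P : probability Omega R}.
Variables (X : {RV P >-> T1}) (Y : {RV P >-> T2}).
Hypothesis XY : independent_RV X Y.

(** Independence prescribes the joint law on measurable rectangles, and these
    determine a measure on the product. *)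
Lemma joint_law_independent (Z : {RV P >-> (T1 * T2)%type}) :
  (forall t, Z t = (X t, Y t)) ->
  forall A, measurable A ->
  (distribution P X \x distribution P Y)%E A = distribution P Z A.
Proof.
move=> ZE; apply: product_measure_unique => A B mA mB /=.
rewrite /distribution /pushforward -XY//; congr (P _).
by apply/seteqP; split => t /=; rewrite ZE.
Qed.

(** Transfer to the joint law, which is a product measure, and apply Fubini
    there; integrability of the product comes from the same computation with
    absolute values. *)
Lemma expectation_mul_independent (f : T1 -> R) (g : T2 -> R) :
  measurable_fun setT f -> measurable_fun setT g ->
  P.-integrable setT (EFin \o (f \o X)) ->
  P.-integrable setT (EFin \o (g \o Y)) ->
  (\int[P]_t (f (X t) * g (Y t))%:E =
   \int[P]_t (f (X t))%:E * \int[P]_t (g (Y t))%:E)%E.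
Proof.
move=> mf mg intf intg.
have mZ : measurable_fun setT (fun t => (X t, Y t)).
  by apply: measurable_fun_pair; exact: measurable_funPT.
pose Z : {RV P >-> (T1 * T2)%type} :=
  HB.pack (fun t => (X t, Y t)) (isMeasurableFun.Build _ _ _ _ _ mZ).
have ZE : forall t, Z t = (X t, Y t) by [].
pose h z : \bar R := (f z.1 * g z.2)%:E.
have mh : measurable_fun setT h.
  apply/measurable_EFinP; apply: measurable_funM.
    exact: measurableT_comp.
  exact: measurableT_comp.
have intX : (distribution P X).-integrable setT (EFin \o f).
  by apply: integrable_pushforward => //; exact/measurable_EFinP.
have intY : (distribution P Y).-integrable setT (EFin \o g).
  by apply: integrable_pushforward => //; exact/measurable_EFinP.
have inth : (distribution P X \x distribution P Y)%E.-integrable setT h.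
  apply/integrable12ltyP => //.
  under eq_integral => x _.
    under eq_integral do rewrite /h/= normrM EFinM.
    rewrite ge0_integralZl//; last first.
      by apply/measurable_EFinP; exact: measurableT_comp.
    over.
  rewrite ge0_integralZr//; first last.
  - exact: integral_ge0.
  - by apply/measurable_EFinP; exact: measurableT_comp.
  have [_ fintX] := integrableP _ _ _ intX.
  have [_ fintY] := integrableP _ _ _ intY.
  rewrite lte_mul_pinfty//; first exact: integral_ge0.
  by rewrite ge0_fin_numE//; exact: integral_ge0.
have lawE := joint_law_independent Z ZE.
have inthZ : (distribution P Z).-integrable setT h.
  apply/integrableP; split => //.
  rewrite (eq_measure_integral (distribution P X \x distribution P Y)%E)//.
    by have [] := integrableP _ _ _ inth.
  by move=> A mA _; exact/esym/lawE.
have -> : (\int[P]_t (f (X t) * g (Y t))%:E = \int[distribution P Z]_z h z)%E.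
  rewrite integral_distribution//; apply/integrableP; split.
    exact: measurableT_comp.
  have [_] := integrableP _ _ _ inthZ.
  by rewrite ge0_integral_distribution//; exact: measurableT_comp.
rewrite (eq_measure_integral (distribution P X \x distribution P Y)%E)//; last first.
  by move=> A mA _; exact/esym/lawE.
rewrite -integral12_prod_meas1// /fubini_F.
under eq_integral => x _.
  under eq_integral do rewrite /h/= EFinM.
  rewrite integralZl//.
  over.
rewrite -(fineK (integrable_fin_num measurableT intY)).
rewrite integralZr// fineK ?integrable_fin_num//.
by rewrite !integral_distribution//; exact/measurable_EFinP.
Qed.

End independence.

(** * Square-integrable variables and the cross term *)

Section square_integrable.
Context {d : measure_display} {Omega : measurableType d} {R : realType}
  {P : probability Omega R}.
Implicit Types a b : Omega -> R.

Lemma integrable_bounded b c : measurable_fun setT b ->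
  (forall t, `|b t| <= c) -> P.-integrable setT (EFin \o b).
Proof.
move=> mb bc; apply: le_integrable (finite_measure_integrable_cst P c _) => //.
  exact/measurable_EFinP.
by move=> t _ /=; rewrite lee_fin (le_trans (bc t))// ler_norm.
Qed.

Lemma integrable_mul_sqr a b :
  measurable_fun setT a -> measurable_fun setT b ->
  P.-integrable setT (fun t => (a t ^+ 2)%:E) ->
  P.-integrable setT (fun t => (b t ^+ 2)%:E) ->
  P.-integrable setT (fun t => (a t * b t)%:E).
Proof.
move=> ma mb ia ib.
apply: le_integrable (integrableD _ ia ib) => //.
  by apply/measurable_EFinP; exact: measurable_funM.
move=> t _ /=; rewrite lee_fin normrM [leRHS]ger0_norm ?addr_ge0 ?sqr_ge0//.
rewrite -(real_normK (num_real (a t))) -(real_normK (num_real (b t))).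
have := sqr_ge0 (`|a t| - `|b t|).
have := mulr_ge0 (normr_ge0 (a t)) (normr_ge0 (b t)).
nra.
Qed.

Lemma integrable_sqr a : measurable_fun setT a ->
  P.-integrable setT (fun t => (a t ^+ 2)%:E) ->
  P.-integrable setT (EFin \o a).
Proof.
move=> ma ia.
have -> : EFin \o a = (fun t => (a t * cst 1 t)%:E).
  by apply/funext => t /=; rewrite mulr1.
apply: integrable_mul_sqr => //.
by apply: (integrable_bounded (fun=> 1 ^+ 2) 1) => // t; rewrite expr1n normr1.
Qed.

Context {d0 d1 d2 : measure_display} {T0 : measurableType d0}
  {T1 : measurableType d1} {T2 : measurableType d2}.
Variables (X : {RV P >-> T0}) (Y : {RV P >-> T1}) (Z : {RV P >-> T2}).
Variables (f : T0 -> R) (g : T1 -> R) (h : T2 -> R).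

(** Neither [g (Y t)] nor [h (Z t)] is assumed integrable, and [X] is
    independent of each of [Y] and [Z] but perhaps not of the pair; hence the
    detour by truncations, for which the two halves of the product can be integrated
    separately. *)
Lemma orthogonal_difference :
  independent_RV X Y -> independent_RV X Z ->
  measurable_fun setT f -> measurable_fun setT g -> measurable_fun setT h ->
  P.-integrable setT (fun t => (f (X t) ^+ 2)%:E) ->
  P.-integrable setT (fun t => ((g (Y t) - h (Z t)) ^+ 2)%:E) ->
  (\int[P]_t (f (X t))%:E = 0)%E ->
  (\int[P]_t (f (X t) * (g (Y t) - h (Z t)))%:E = 0)%E.
Proof.
move=> XY XZ mf mg mh if2 igh f0.
have mfX : measurable_fun setT (f \o X) by exact: measurableT_comp.
have mgY : measurable_fun setT (g \o Y) by exact: measurableT_comp.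
have mhZ : measurable_fun setT (h \o Z) by exact: measurableT_comp.
have mD : measurable_fun setT (fun t => g (Y t) - h (Z t)).
  exact: measurable_funB.
have ifX : P.-integrable setT (EFin \o (f \o X)) by exact: integrable_sqr.
have mclamp n (b : Omega -> R) : measurable_fun setT b ->
    measurable_fun setT (clamp R n \o b).
  by move=> mb; apply: measurableT_comp => //; exact: measurable_clamp.
have iclamp n (b : Omega -> R) : measurable_fun setT b ->
    P.-integrable setT (EFin \o (clamp R n \o b)).
  move=> mb; apply: (integrable_bounded _ n%:R); first exact: mclamp.
  by move=> t; exact: clamp_le.
have iprod n (b : Omega -> R) : measurable_fun setT b ->
    P.-integrable setT (fun t => (f (X t) * clamp R n (b t))%:E).
  move=> mb; apply: (integrable_mul_sqr (f \o X) (clamp R n \o b)) => //.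
    exact: mclamp.
  apply: (integrable_bounded (fun t => clamp R n (b t) ^+ 2) (n%:R ^+ 2)).
    by apply: measurable_funX; exact: mclamp.
  by move=> t; rewrite normrX lerXn2r ?nnegrE//; exact: clamp_le.
pose F n t : \bar R := (f (X t) * (clamp R n (g (Y t)) - clamp R n (h (Z t))))%:E.
(* Truncations are bounded, so linearity and the product rule apply. *)
have F0 n : (\int[P]_t F n t = 0)%E.
  rewrite /F; under eq_integral do rewrite mulrBr EFinB.
  rewrite integralB//; [|exact: (iprod n (g \o Y))|exact: (iprod n (h \o Z))].
  rewrite (expectation_mul_independent X Y XY f (clamp R n \o g))//; last 2 first.
  - by apply: measurableT_comp => //; exact: measurable_clamp.
  - exact: (iclamp n (g \o Y)).
  rewrite (expectation_mul_independent X Z XZ f (clamp R n \o h))//; last 2 first.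
  - by apply: measurableT_comp => //; exact: measurable_clamp.
  - exact: (iclamp n (h \o Z)).
  by rewrite f0 !mul0e sube0.
have mF n : measurable_fun setT (F n).
  apply/measurable_EFinP; apply: measurable_funM => //.
  by apply: measurable_funB; [exact: (mclamp n (g \o Y))|exact: (mclamp n (h \o Z))].
(* The integrals of [F n] are all zero; let [n] tend to infinity. *)
have [||||_ _] := @dominated_convergence _ _ _ P setT measurableT F
  (fun t => (f (X t) * (g (Y t) - h (Z t)))%:E)
  (fun t => `|f (X t) * (g (Y t) - h (Z t))|%:E) mF.
- by apply/measurable_EFinP; exact: measurable_funM.
- apply: aeW => t _; apply: cvg_EFin; first exact: nearW.
  by apply: cvgMr; apply: cvgB; exact: cvg_clamp.
- apply: (integrable_abse (f := fun t => (f (X t) * (g (Y t) - h (Z t)))%:E)).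
  exact: (integrable_mul_sqr (f \o X)).
- apply: aeW => t n _; rewrite lee_fin !normrM ler_wpM2l//.
  exact: clamp_lipschitz.
move=> /cvg_lim <-//; apply: lim_near_cst => //.
by apply: nearW => n; exact: F0.
Qed.

End square_integrable.

(** * Mean squares of random vectors *)

Section mean_square.
Context {d : measure_display} {Omega : measurableType d} {R : realType}
  {P : probability Omega R} {M : nat}.
Implicit Types u v : Omega -> 'rV[R]_M.

Lemma mean_sq_ge0 u : (0 <= mean_sq P u)%E.
Proof. by apply: expectation_ge0 => t; exact: sqr_ge0. Qed.

Lemma mean_sqE u : (forall j, measurable_fun setT (fun t => u t ord0 j)) ->
  (mean_sq P u = \sum_(j < M) \int[P]_t (u t ord0 j ^+ 2)%:E)%E.
Proof.
move=> mu; rewrite /mean_sq unlock.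
rewrite -ge0_integral_sum//; last 2 first.
- by move=> j; apply/measurable_EFinP; exact: measurable_funX.
- by move=> j t _; rewrite lee_fin sqr_ge0.
apply: eq_integral => t _; rewrite sumEFin sqr_sqrtr//.
by apply: sumr_ge0 => j _; exact: sqr_ge0.
Qed.

Lemma integrable_coord_sqr u j :
  (forall j, measurable_fun setT (fun t => u t ord0 j)) ->
  (mean_sq P u < +oo)%E ->
  P.-integrable setT (fun t => (u t ord0 j ^+ 2)%:E).
Proof.
move=> mu; rewrite mean_sqE// => uoo; apply/integrableP; split.
  by apply/measurable_EFinP; exact: measurable_funX.
under eq_integral do rewrite gee0_abs ?lee_fin ?sqr_ge0//.
apply: le_lt_trans uoo; rewrite (bigD1 j)//= leeDl//.
by apply: sume_ge0 => k _; apply: integral_ge0 => t _; rewrite lee_fin sqr_ge0.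
Qed.

(** Convexity of the square: [a + b] is the average of [a / s] and
    [b / (1 - s)] with weights [s] and [1 - s]. *)
Lemma mean_sqD_le (s : R) u v : 0 < s < 1 ->
  (forall j, measurable_fun setT (fun t => u t ord0 j)) ->
  (forall j, measurable_fun setT (fun t => v t ord0 j)) ->
  (mean_sq P (fun t => u t + v t)%R <=
    (s^-1)%:E * mean_sq P u + ((1 - s)^-1)%:E * mean_sq P v)%E.
Proof.
move=> /andP[s0 s1] mu mv.
have s1' : 0 < 1 - s by rewrite subr_gt0.
have sq0 (b : Omega -> R) t : [set: Omega] t -> (0 <= (b t ^+ 2)%:E)%E.
  by rewrite lee_fin sqr_ge0.
have msq (b : Omega -> R) : measurable_fun setT b ->
    measurable_fun setT (fun t => (b t ^+ 2)%:E).
  by move=> mb; apply/measurable_EFinP; exact: measurable_funX.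
have muv j : measurable_fun setT (fun t => (u t + v t) ord0 j).
  under eq_fun do rewrite mxE.
  exact: measurable_funD.
rewrite !mean_sqE// !ge0_sume_distrr; last 2 first.
- by move=> j _; apply: integral_ge0; exact: sq0.
- by move=> j _; apply: integral_ge0; exact: sq0.
rewrite -big_split/=; apply: lee_sum => j _.
rewrite -!ge0_integralZl//; try exact: sq0; try exact: msq;
  try by rewrite lee_fin invr_ge0 ltW.
rewrite -ge0_integralD//; last 4 first.
- by move=> t _; rewrite -EFinM lee_fin mulr_ge0 ?sqr_ge0// invr_ge0 ltW.
- by apply: measurable_funeM; exact: msq.
- by move=> t _; rewrite -EFinM lee_fin mulr_ge0 ?sqr_ge0// invr_ge0 ltW.
- by apply: measurable_funeM; exact: msq.
apply: ge0_le_integral => //.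
- exact: sq0.
- exact: msq.
- by apply: emeasurable_funD; apply: measurable_funeM; exact: msq.
move=> t _; rewrite mxE -!EFinM -EFinD lee_fin -subr_ge0.
set a := u t ord0 j; set b := v t ord0 j.
(* The gap in the convexity inequality is a square. *)
have -> : s^-1 * a ^+ 2 + (1 - s)^-1 * b ^+ 2 - (a + b) ^+ 2 =
    ((1 - s) * a - s * b) ^+ 2 / (s * (1 - s)).
  by field; rewrite !gt_eqF.
by rewrite divr_ge0 ?sqr_ge0// mulr_ge0// ltW.
Qed.

Lemma mean_sqD_orthogonal u v :
  (forall j, measurable_fun setT (fun t => u t ord0 j)) ->
  (forall j, measurable_fun setT (fun t => v t ord0 j)) ->
  (mean_sq P u < +oo)%E -> (mean_sq P v < +oo)%E ->
  (forall j, \int[P]_t (v t ord0 j * u t ord0 j)%:E = 0)%E ->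
  (mean_sq P (fun t => u t + v t)%R = mean_sq P u + mean_sq P v)%E.
Proof.
move=> mu mv uoo voo uv0.
have muv j : measurable_fun setT (fun t => (u t + v t) ord0 j).
  under eq_fun do rewrite mxE.
  exact: measurable_funD.
rewrite !mean_sqE// -big_split/=; apply: eq_bigr => j _.
have iu := integrable_coord_sqr _ j mu uoo.
have iv := integrable_coord_sqr _ j mv voo.
have iuv := integrable_mul_sqr _ _ (mv j) (mu j) iv iu.
have expand t : (((u t + v t) ord0 j ^+ 2)%:E =
    (u t ord0 j ^+ 2)%:E + (v t ord0 j ^+ 2)%:E
      + 2%:E * (v t ord0 j * u t ord0 j)%:E)%E.
  by rewrite mxE -EFinM -!EFinD; congr EFin; ring.
under eq_integral do rewrite expand.
rewrite integralD//; last 2 first.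
- exact: integrableD.
- exact: integrableZl.
by rewrite integralD// integralZl// uv0 mule0 adde0.
Qed.

End mean_square.
(** * The tracking bounds *)

Theorem theorem1 (R : realType) (d dX : measure_display)
  (Omega : measurableType d) (P : probability Omega R)
  (M : nat) (X : measurableType dX)
  (T : nat -> 'rV[R]_M -> X -> 'rV[R]_M) (x : nat -> {RV P >-> X})
  (w winf q : nat -> {RV P >-> 'rV[R]_M})
  (gamma delta : nat -> R) (Gamma Delta xi : R)
  (w_gen : generated T x w)
  (T_contr : ms_contractive T x winf gamma delta)
  (gamma_ge0_lt1 : forall i, (1 <= i)%N -> 0 <= gamma i < 1)
  (delta_ge0 : forall i, (1 <= i)%N -> 0 <= delta i)
  (Gamma_ge0_lt1 : 0 <= Gamma < 1)
  (Delta_ge0 : 0 <= Delta)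
  (gamma_le : forall i, (1 <= i)%N -> gamma i <= Gamma)
  (delta_le : forall i, (1 <= i)%N -> delta i <= Delta)
  (random_walk : forall i t, winf i.+1 t = winf i t + q i.+1 t)
  (q_indep : forall i, independent_RV (q i.+1) (winf i))
  (q_msq : forall i, (1 <= i)%N -> (mean_sq P (q i) <= (xi ^+ 2)%:E)%E)
  (w0_msq : (mean_sq P (fun t => winf 0%N t - w 0%N t)%R < +oo)%E) :
  (exists2 C : R, 0 <= C & forall i : nat, (1 <= i)%N ->
     (mean_sq P (fun t => winf i t - w i t)%R <=
       (C * Gamma `^ (i%:R / 2) + xi ^+ 2 / (1 - Num.sqrt Gamma) ^+ 2
         + Delta / (1 - Num.sqrt Gamma))%:E)%E)
  /\
  ((forall i, (1 <= i)%N -> mean_zero P (q i)) ->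
   (forall i, independent_RV (q i.+1) (w i)) ->
   exists2 C : R, 0 <= C & forall i : nat, (1 <= i)%N ->
     (mean_sq P (fun t => winf i t - w i t)%R <=
       (C * Gamma ^+ i + xi ^+ 2 / (1 - Gamma) + Delta / (1 - Gamma))%:E)%E).
Proof.
have mcoord (W : {RV P >-> 'rV[R]_M}) j :
    measurable_fun setT (fun t => W t ord0 j).
  exact: (measurableT_comp (measurable_coord R M j) (measurable_funPT W)).
have mtilde i j : measurable_fun setT (fun t => (winf i t - w i t) ord0 j).
  by under eq_fun do rewrite !mxE; exact: measurable_funB.
have [G0 G1] := andP Gamma_ge0_lt1.
set s := Num.sqrt Gamma.
have s0 : 0 <= s by exact: sqrtr_ge0.
have ss : s ^+ 2 = Gamma by exact: sqr_sqrtr.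
have s1 : s < 1 by rewrite -sqrtr1 ltr_sqrt.
have s1' : 0 < 1 - s by rewrite subr_gt0.
pose a i := mean_sq P (fun t => winf i t - w i t).
have a0fin : a 0%N \is a fin_num by rewrite ge0_fin_numE//; exact: mean_sq_ge0.
have C0 : 0 <= fine (a 0%N) by apply: fine_ge0; exact: mean_sq_ge0.
have aS i : (a i.+1 <=
    Gamma%:E * mean_sq P (fun t => (winf i t - w i t) + q i.+1 t)%R
      + Delta%:E)%E.
  apply: (le_trans (T_contr.2 w w_gen i)).
  rewrite (_ : (fun t => winf i.+1 t - w i t) =
               (fun t => (winf i t - w i t) + q i.+1 t)); last first.
    by apply/funext => t; rewrite random_walk addrAC.
  apply: leeD; last by rewrite lee_fin delta_le.
  by apply: lee_wpmul2r; [exact: mean_sq_ge0|rewrite lee_fin gamma_le].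
have part1 i : (a i <= (fine (a 0%N) * s ^+ i +
    (xi ^+ 2 / (1 - s) + Delta) / (1 - s))%:E)%E.
  apply: affine_recursion.
  - by rewrite s0.
  - by rewrite addr_ge0// divr_ge0 ?sqr_ge0// ltW.
  - by rewrite fineK.
  move=> {}i; apply: (le_trans (aS i)).
  rewrite EFinD addeA leeD2r//.
  (* For [Gamma = 0] the weight [1 / s] is meaningless, but the whole product
     vanishes, whatever the mean square is. *)
  have [s_eq0|s_neq0] := eqVneq s 0.
    rewrite -ss s_eq0 expr0n/= !mul0e add0e lee_fin.
    by rewrite divr_ge0 ?sqr_ge0// subr0.
  have spos : 0 < s by rewrite lt_neqAle eq_sym s_neq0.
  have sbnd : 0 < s < 1 by rewrite spos.
  have split_step :=
    mean_sqD_le (P := P) s _ _ sbnd (mtilde i) (mcoord (q i.+1)).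
  apply: (le_trans (lee_wpmul2l _ split_step)); first by rewrite lee_fin.
  rewrite ge0_muleDr; last 2 first.
  - by rewrite mule_ge0 ?mean_sq_ge0// lee_fin invr_ge0.
  - by rewrite mule_ge0 ?mean_sq_ge0// lee_fin invr_ge0 ltW.
  rewrite !muleA -!EFinM -ss expr2 -mulrA divff// mulr1 leeD2l//.
  apply: (@le_trans _ _ ((s * s / (1 - s))%:E * (xi ^+ 2)%:E)%E).
    by rewrite lee_wpmul2l ?q_msq// lee_fin divr_ge0 ?mulr_ge0// ltW.
  rewrite -EFinM lee_fin mulrAC ler_pM2r ?invr_gt0//.
  by rewrite ler_piMl ?sqr_ge0// mulr_ile1// ltW.
(* Finiteness of all the errors, needed for the cross term, comes for free from
   the first bound. *)
have afin i : (a i < +oo)%E by apply: le_lt_trans (part1 i) (ltry _).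
split.
  exists (fine (a 0%N)) => // i i1; apply: le_trans (part1 i) _.
  rewrite lee_fin [i%:R / 2]mulrC powRrM powR12_sqrt// powR_mulrn//.
  by rewrite mulrDl addrA -mulrA -invfM expr2.
move=> q_mean0 q_indep_w; exists (fine (a 0%N)) => // i _.
apply: (@le_trans _ _ (fine (a 0%N) * Gamma ^+ i +
    (Gamma * xi ^+ 2 + Delta) / (1 - Gamma))%:E).
  move: i; apply: affine_recursion => //.
  - by rewrite addr_ge0// mulr_ge0// sqr_ge0.
  - by rewrite fineK.
  move=> i; apply: (le_trans (aS i)).
  have qoo : (mean_sq P (q i.+1) < +oo)%E.
    exact: le_lt_trans (q_msq _ _) (ltry _).
  have cross0 j :
      (\int[P]_t (q i.+1 t ord0 j * (winf i t - w i t) ord0 j)%:E = 0)%E.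
    under eq_integral do rewrite !mxE.
    apply: (orthogonal_difference (q i.+1) (winf i) (w i)
      (fun v => v ord0 j) (fun v => v ord0 j) (fun v => v ord0 j)) => //;
      try exact: measurable_coord.
    + exact: integrable_coord_sqr.
    + have := integrable_coord_sqr _ j (mtilde i) (afin i).
      by under eq_fun do rewrite !mxE.
    + by have := q_mean0 i.+1 isT j; rewrite unlock.
  rewrite (mean_sqD_orthogonal _ _ (mtilde i) (mcoord (q i.+1)) (afin i) qoo
    cross0) EFinD addeA leeD2r//.
  rewrite ge0_muleDr ?mean_sq_ge0// leeD2l// EFinM.
  by rewrite lee_wpmul2l ?q_msq.
rewrite lee_fin -addrA lerD2l -mulrDl ler_pM2r ?invr_gt0 ?subr_gt0//.
by rewrite lerD2r ler_piMl ?sqr_ge0// ltW.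
Qed.
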